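(* Let $f$ be a $C^2$ function defined on a neighborhood of a point $x_0\in\mathbb{R}$, and let $w$ be a kernel function satisfying the Normalization Constraint with parameter $W>0$ (for each $W>0$). Then the second-order Tao Derivative $$f''_{\mathrm{TD}}(x_0;w)=\lim_{W\to 0}\frac{\int_0^W f(x_0+t)\,w(t)\,dt+\int_0^W f(x_0-t)\,w(t)\,dt-2f(x_0)\int_0^W w(t)\,dt}{\int_0^W t^2\,w(t)\,dt}$$ exists and equals $f''(x_0)=\lim_{\Delta x\to 0}\frac{f'(x_0+\Delta x)-f'(x_0)}{\Delta x}$.
   Context: Normalization Constraint: for a parameter $W>0$, a (Lebesgue integrable) function $w:\mathbb{R}\to\mathbb{R}$ satisfies the Normalization Constraint with parameter $W$ if $\int_0^W w(t)\,dt=1$, $w(t)>0$ for $t\in(0,W]$, and $w(t)=0$ for $t\in(-\infty,0]\cup(W,\infty)$. The kernel $w$ depends on $W$ (one kernel for each $W>0$), and the limit $W\to 0$ is taken over this family. *)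

(* Defs.v *)
From HB Require Import structures.
From mathcomp Require Import all_boot all_order all_algebra.
From mathcomp Require Import all_classical all_reals all_analysis.

Set Implicit Arguments.
Unset Strict Implicit.
Unset Printing Implicit Defensive.

Import Order.TTheory GRing.Theory Num.Theory.
Import numFieldNormedType.Exports.

Local Open Scope ring_scope.
Local Open Scope classical_set_scope.

(* [completed_lebesgue_measure] rather than [lebesgue_measure]: the latter
   lives on the Borel sigma-algebra only, so its integrable functions are
   Borel measurable.  The carrier type of the completed measure is an alias
   of [R]. *)
Definition leb_integrable (R : realType) (D : set R) (g : R -> R) : Prop :=
  (@completed_lebesgue_measure R).-integrable D (EFin \o g).

Definition leb_int (R : realType) (D : set R) (g : R -> R) : R :=
  Rintegral (@completed_lebesgue_measure R) D g.

Definition normalization_constraint (R : realType) (W : R) (w : R -> R) :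
    Prop :=
  [/\ leb_integrable [set: R] w,
      leb_int `[0, W] w = 1,
      forall t, 0 < t <= W -> 0 < w t
    & forall t, t <= 0 \/ W < t -> w t = 0].

(* [f] is a total function, but only its restriction to the open set [U]
   matters: derivatives at points of [U] depend on [f] on [U] only. *)
Definition C2_on (R : realType) (U : set R) (f : R -> R) : Prop :=
  forall x, U x ->
    [/\ derivable f x 1, derivable f^`() x 1 & {for x, continuous f^`(2)}].

Definition tao_quotient2 (R : realType) (f : R -> R) (x0 : R) (W : R)
    (w : R -> R) : R :=
  (leb_int `[0, W] (fun t => f (x0 + t) * w t)
   + leb_int `[0, W] (fun t => f (x0 - t) * w t)
   - 2 * f x0 * leb_int `[0, W] w)
  / leb_int `[0, W] (fun t => t ^+ 2 * w t).

(* The kernel is a family: [w W] is the kernel with parameter [W]. *)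
Definition tao_derive2 (R : realType) (f : R -> R) (x0 : R)
    (w : R -> R -> R) : R :=
  lim (tao_quotient2 f x0 W (w W) @[W --> 0^'+]).

(* Main.v *)
(* By differentiability of [f'] at [x0],
   [|f(x0+t) + f(x0-t) - 2 f(x0) - f''(x0) t^2| <= e t^2] for small [t >= 0].
   Integrating against [w >= 0] bounds the numerator of the quotient minus
   [f''(x0) * \int t^2 w] by [e * \int t^2 w], whatever the kernels are; since
   [\int t^2 w > 0], the quotient is within [e] of [f''(x0)]. *)

Require Import Defs.
From HB Require Import structures.
From mathcomp Require Import all_boot all_order all_algebra.
From mathcomp Require Import all_classical all_reals all_analysis.
From mathcomp Require Import measurable_realfun.
From mathcomp Require Import ring.

Import Order.TTheory GRing.Theory Num.Theory.
Import numFieldNormedType.Exports.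

Local Open Scope ring_scope.
Local Open Scope classical_set_scope.

(** * Difference quotients and the pointwise estimate of the second difference *)

Lemma derive1_cvg_diff_quot (R : realType) (g : R -> R) (x : R) :
  derivable g x 1 -> (g (x + h) - g x) / h @[h --> 0^'] --> g^`()%classic x.
Proof.
move=> dg; rewrite derive1E.
have := dg; rewrite /derivable => /cvgP.
rewrite (_ : (fun h => (g (x + h) - g x) / h) =
  (fun h => h^-1 *: (g (h *: (1 : R) + x) - g x))); first exact.
apply/funext => h.
by rewrite -[h *: 1]/(h * 1) mulr1 (addrC h) -[RHS]/(_ * _) mulrC.
Qed.

(** First-order expansion with the division cleared, so that the estimates at [s] and at [- s] can
    later be added. *)
Lemma derive1_diff_bound (R : realType) (g : R -> R) (x e : R) :
    derivable g x 1 -> 0 < e ->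
  \forall h \near 0^', `|g (x + h) - g x - g^`()%classic x * h| <= e * `|h|.
Proof.
move=> dg e0; have /cvgrPdist_le/(_ _ e0) := derive1_cvg_diff_quot _ _ _ dg.
apply: filter_app; near=> h.
have h0 : h != 0 by near: h; exact: nbhs_dnbhs_neq.
rewrite distrC => le_e.
have -> : g (x + h) - g x - g^`()%classic x * h =
          ((g (x + h) - g x) / h - g^`()%classic x) * h by field.
by rewrite normrM ler_wpM2r.
Unshelve. all: by end_near. Qed.

Lemma is_derive_shiftl (R : realType) (f : R -> R) (x s : R) :
  derivable f (x + s) 1 ->
  is_derive s 1 (fun s => f (x + s)) (f^`()%classic (x + s)).
Proof.
move=> df.
have Df : is_derive (x + s) 1 f (f^`()%classic (x + s)).
  by split => //; rewrite derive1E.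
have Dg : is_derive s 1 (fun s : R => x + s) (0 + 1) by exact: is_deriveD.
by have := is_derive1_comp Df Dg; rewrite add0r mulr1.
Qed.

Lemma is_derive_reflect (R : realType) (f : R -> R) (x s : R) :
  derivable f (x - s) 1 ->
  is_derive s 1 (fun s => f (x - s)) (- f^`()%classic (x - s)).
Proof.
move=> df.
have Df : is_derive (x - s) 1 f (f^`()%classic (x - s)).
  by split => //; rewrite derive1E.
have Dg : is_derive s 1 (fun s : R => x - s) (0 - 1) by exact: is_deriveB.
have := @is_derive1_comp R f (fun s => x - s) _ _ _ Df Dg.
by rewrite sub0r mulrN1.
Qed.

(* The second difference has derivative [f'(x0+t) - f'(x0-t)], which is
   [2 f''(x0) t + o(t)] by differentiability of [f'] at [x0] alone; the mean
   value theorem on [[0, t]] then gives the bound. *)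
Lemma second_difference_bound (R : realType) (f : R -> R) (x0 e : R) :
    (\forall x \near x0, derivable f x 1) -> derivable f^`()%classic x0 1 ->
    0 < e ->
  \forall d \near 0^'+, forall t, 0 <= t <= d ->
    `|f (x0 + t) + f (x0 - t) - 2 * f x0 - f^`(2)%classic x0 * t ^+ 2|
      <= e * t ^+ 2.
Proof.
move=> df ddf e0.
(* The expansions of [f'] at [x0 + s] and at [x0 - s] each contribute an error of at most
   [e / 2 * s]. *)
have e20 : 0 < e / 2 by rewrite divr_gt0.
have := derive1_diff_bound _ _ _ _ ddf e20.
rewrite -[f^`()^`()%classic]/(f^`(2)%classic) => /nbhs_ballP [d1 /= d10 H1].
have /nbhs_ballP [d2 /= d20 H2] := df.
set a := f^`(2)%classic x0.
near=> d => t /andP[t0 td].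
have dd1 : d < d1 by near: d; exact: nbhs_right_lt.
have dd2 : d < d2 by near: d; exact: nbhs_right_lt.
pose G (s : R) := f (x0 + s) + f (x0 - s) - 2 * f x0 - a * s ^+ 2.
pose dG (s : R) := f^`()%classic (x0 + s) - f^`()%classic (x0 - s) - 2 * a * s.
have G_derive (s : R) : `|s| < d2 -> is_derive s 1 G (dG s).
  move=> sd.
  have dp : derivable f (x0 + s) 1.
    by apply: H2; rewrite /ball /= opprD addNKr normrN.
  have dm : derivable f (x0 - s) 1.
    by apply: H2; rewrite /ball /= opprB addrC subrK.
  have D1 := is_derive_shiftl _ _ _ _ dp.
  have D2 := is_derive_reflect _ _ _ _ dm.
  have D3 : is_derive s 1 (fun s : R => a * s ^+ 2) (a * (2 * s)).
    by apply: is_derive_eq; rewrite /GRing.scale /=; ring.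
  have D12 := @is_deriveD _ _ _ _ _ _ _ _ _ D1 D2.
  have D12c := @is_deriveB _ _ _ _ _ _ _ _ _ D12
    (is_derive_cst (2 * f x0) s 1).
  have := @is_deriveB _ _ _ _ _ _ _ _ _ D12c D3.
  by move=> DG; apply: is_derive_eq; rewrite /dG; ring.
have dG_bound (s : R) : 0 < s -> s < d1 -> `|dG s| <= e * s.
  move=> s0 sd.
  have := H1 s; have := H1 (- s).
  rewrite /ball /= !sub0r !normrN (gtr0_norm s0) sd oppr_eq0 gt_eqF//.
  move=> /(_ isT isT) Bm /(_ isT isT) Bp.
  (* Subtracting the two expansions cancels [f'(x0)] and adds up the linear terms to [2 * a * s]. *)
  have -> : dG s = (f^`()%classic (x0 + s) - f^`()%classic x0 - a * s)
         - (f^`()%classic (x0 - s) - f^`()%classic x0 - a * (- s)).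
    by rewrite /dG; ring.
  rewrite (le_trans (ler_normB _ _))// (le_trans (lerD Bp Bm))//.
  by rewrite -mulrDl -splitr.
rewrite -/(G t).
have G0 : G 0 = 0 by rewrite /G addr0 subr0; ring.
(* The mean value theorem needs a nondegenerate interval. *)
have [->|t_neq0] := eqVneq t 0; first by rewrite G0 normr0 expr0n mulr0.
have t_gt0 : 0 < t by rewrite lt_def t_neq0.
have td1 : t < d1 by exact: le_lt_trans dd1.
have td2 : t < d2 by exact: le_lt_trans dd2.
have [c||c] := @MVT _ G dG 0 t t_gt0.
- rewrite in_itv /= => /andP[c0 ct]; apply: G_derive.
  by rewrite gtr0_norm// (lt_trans ct).
- apply: derivable_within_continuous => s.
  rewrite in_itv /= => /andP[s0 st].
  apply: (@ex_derive _ _ _ _ _ _ _ (G_derive s _)).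
  by rewrite ger0_norm// (le_lt_trans st).
rewrite in_itv /= => /andP[c0 ct].
(* Since [G 0 = 0], the mean value theorem gives [G t = dG c * t], and
   [|dG c| <= e * c <= e * t]. *)
rewrite G0 !subr0 => ->; rewrite normrM (gtr0_norm t_gt0) expr2 mulrA.
rewrite ler_pM2r// (le_trans (dG_bound c c0 (lt_trans ct td1)))//.
by rewrite ler_pM2l// ltW.
Unshelve. all: by end_near. Qed.

(** * Integration against the kernel for the completed Lebesgue measure *)

Local Notation leb_type R := (caratheodory_type ((@wlength R idfun)^*)%mu).
Local Notation leb := (@completed_lebesgue_measure _).

Lemma completed_measurable (R : realType) (D : set R) :
  measurable D -> (@wlength R idfun)^*%mu.-cara.-measurable D.
Proof. by move=> mD; exact: sub_caratheodory. Qed.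

Lemma completed_measurable_fun (R : realType) (D : set R) (g : R -> R) :
  measurable D ->
  measurable_fun D g -> @measurable_fun _ _ (leb_type R) R D g.
Proof. by move=> mD mg _ Y mY; apply: completed_measurable; exact: mg. Qed.

(** A continuous function is bounded on the compact segment and Borel measurable, hence measurable
    for the completed measure; a bounded measurable factor preserves integrability. This covers
    every integrand of the quotient, with constants, [t ^+ 2] or values of [f] as the continuous
    factor. *)
Lemma leb_integrableM (R : realType) (a b : R) (g h : R -> R) :
  {within `[a, b], continuous g} -> leb_integrable `[a, b] h ->
  leb_integrable `[a, b] (fun t => g t * h t).
Proof.
move=> cg ih.
have mab : (@wlength R idfun)^*%mu.-cara.-measurable `[a, b].
  exact: completed_measurable.
have mg : @measurable_fun _ _ (leb_type R) R `[a, b] g.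
  apply: completed_measurable_fun => //.
  by apply: subspace_continuous_measurable_fun.
have bg : [bounded g x | x in `[a, b]].
  have /compact_bounded[M [_ mrt]] :=
    continuous_compact cg (@segment_compact R a b).
  by exists M; split; rewrite ?num_real // => ? ? ? ?; exact: mrt.
exact: eq_integrable (integrableMr mab mg bg ih).
Qed.

Lemma kernel_ge0 (R : realType) (W : R) (w : R -> R) :
  normalization_constraint W w -> forall t, `[0, W]%classic t -> 0 <= w t.
Proof.
move=> [_ _ wpos w0] t.
rewrite /= in_itv /= => /andP[]; rewrite le_eqVlt => /predU1P[<- _|t0 tW].
  by rewrite w0//; left.
by rewrite ltW// wpos// t0.
Qed.

(* If the integral vanished, [w] would be zero almost everywhere on [[0, W]],
   contradicting [\int w = 1]. *)
Lemma leb_int_sqr_gt0 (R : realType) (W : R) (w : R -> R) :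
  0 < W -> normalization_constraint W w ->
  0 < leb_int `[0, W] (fun t => t ^+ 2 * w t).
Proof.
move=> W0 nw; have [iw w1 _ w0] := nw.
have mD : (@wlength R idfun)^*%mu.-cara.-measurable `[0, W].
  exact: completed_measurable.
have iwW : leb_integrable `[0, W] w by exact: integrableS iw.
have i2 : leb_integrable `[0, W] (fun t => t ^+ 2 * w t).
  apply: leb_integrableM => //.
  by apply: continuous_subspaceT; exact: exprn_continuous.
have int0 : 0 <= leb_int `[0, W] (fun t => t ^+ 2 * w t).
  apply: Rintegral_ge0 => t /(kernel_ge0 _ _ _ nw) wt.
  by rewrite mulr_ge0// sqr_ge0.
rewrite lt_neqAle int0 andbT; apply/eqP => /esym int_eq0.
(* The integrand is nonnegative on [[0, W]], so the absolute value leaves its integral unchanged. *)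
have eint0 : (\int[leb]_(t in `[0%R, W]) `|(t ^+ 2 * w t)%:E| = 0)%E.
  under eq_integral => t.
    rewrite inE => /(kernel_ge0 _ _ _ nw) wt.
    rewrite gee0_abs; last by rewrite lee_fin mulr_ge0// sqr_ge0.
    over.
  rewrite -[LHS]fineK; last exact: integrable_fin_num.
  by rewrite -[fine _]/(leb_int _ _) int_eq0.
have ae0 : ae_eq leb `[0, W] (EFin \o (fun t => t ^+ 2 * w t)) (cst 0%E).
  apply/ae_eq_integral_abs => //; exact: measurable_int i2.
have aew0 : ae_eq leb `[0, W] (EFin \o w) (cst 0%E).
  (* Either [w t = 0] or [t = 0], and the kernel vanishes at 0 as well. *)
  apply: filterS ae0 => t /= h tD; have [[/eqP]] := h tD.
  rewrite mulf_eq0 expf_eq0 /= => /orP[/eqP ->|/eqP -> //].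
  by rewrite w0//; left.
have : leb_int `[0, W] w = 0.
  rewrite /leb_int /Rintegral.
  rewrite (ae_eq_integral _ _ mD _ _ aew0)//; last exact: measurable_int iwW.
  by rewrite integral0.
by rewrite w1 => /eqP; rewrite oner_eq0.
Qed.

(** Here [W] is fixed and no limit is involved; the continuity hypotheses make the integrands
    integrable, so that linearity merges the numerator and [a] times the denominator into one
    integral. *)
Lemma tao_quotient2_dist_le (R : realType) (f : R -> R) (x0 a e W : R)
    (w : R -> R) :
    0 < W -> normalization_constraint W w ->
    {within `[0, W], continuous (fun t => f (x0 + t))} ->
    {within `[0, W], continuous (fun t => f (x0 - t))} ->
    (forall t, 0 <= t <= W ->
      `|f (x0 + t) + f (x0 - t) - 2 * f x0 - a * t ^+ 2| <= e * t ^+ 2) ->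
  `|tao_quotient2 f x0 W w - a| <= e.
Proof.
move=> W0 nw cp cm bound.
have den_gt0 := leb_int_sqr_gt0 _ _ _ W0 nw.
have [iw _ _ _] := nw.
have mD : (@wlength R idfun)^*%mu.-cara.-measurable `[0, W].
  exact: completed_measurable.
have iwW : leb_integrable `[0, W] w by exact: integrableS iw.
have ip := leb_integrableM _ _ _ _ _ cp iwW.
have im := leb_integrableM _ _ _ _ _ cm iwW.
have i2 : leb_integrable `[0, W] (fun t => t ^+ 2 * w t).
  apply: leb_integrableM => //.
  by apply: continuous_subspaceT; exact: exprn_continuous.
have icst c h : leb_integrable `[0, W] h ->
    leb_integrable `[0, W] (fun t => c * h t).
  by apply: leb_integrableM; apply: continuous_subspaceT => ?; exact: cvg_cst.
have ipm : leb_integrable `[0, W]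
    (fun t => f (x0 + t) * w t + f (x0 - t) * w t).
  exact: (integrableD mD ip im).
have ipmc : leb_integrable `[0, W]
    (fun t => f (x0 + t) * w t + f (x0 - t) * w t - 2 * f x0 * w t).
  exact: (integrableB mD ipm (icst _ _ iwW)).
have iall : leb_integrable `[0, W]
    (fun t => f (x0 + t) * w t + f (x0 - t) * w t - 2 * f x0 * w t
              - a * (t ^+ 2 * w t)).
  exact: (integrableB mD ipmc (icst _ _ i2)).
rewrite /tao_quotient2; set N := (X in `|X / _ - _|).
set D := leb_int _ _ in den_gt0 *.
have NE : N - a * D = leb_int `[0, W] (fun t =>
    f (x0 + t) * w t + f (x0 - t) * w t - 2 * f x0 * w t
    - a * (t ^+ 2 * w t)).
  by rewrite /leb_int !RintegralB ?RintegralD ?RintegralZl//; exact: icst.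
have -> : N / D - a = (N - a * D) / D by field; rewrite gt_eqF.
rewrite normrM normfV (gtr0_norm den_gt0) ler_pdivrMr// NE.
apply: (le_trans (le_normr_Rintegral mD iall)).
rewrite -RintegralZl//; apply: le_Rintegral => //.
- exact: integrable_norm iall.
- exact: icst.
move=> t t0W; have wt := kernel_ge0 _ _ _ nw t t0W.
(* Factoring out [w t >= 0] exposes the second difference, to which the pointwise bound applies. *)
rewrite [X in `|X|](_ : _ =
  (f (x0 + t) + f (x0 - t) - 2 * f x0 - a * t ^+ 2) * w t); last by ring.
by rewrite normrM (ger0_norm wt) mulrA ler_wpM2r// bound.
Qed.

Theorem theorem3 (R : realType) (f : R -> R) (x0 : R) (U : set R)
    (w : R -> R -> R)
    (U_x0 : open_nbhs x0 U)
    (f_C2 : C2_on U f)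
    (w_norm : forall W : R, 0 < W -> normalization_constraint W (w W)) :
  [/\ cvg (tao_quotient2 f x0 W (w W) @[W --> 0^'+]),
      tao_derive2 f x0 w = f^`(2) x0
    & (f^`()%classic (x0 + dx) - f^`()%classic x0) / dx @[dx --> 0^'] --> f^`(2) x0].
Proof.
have [oU Ux0] := U_x0.
have [_ ddf _] := f_C2 _ Ux0.
have nearU : \forall x \near x0, U x by exact: open_nbhs_nbhs.
have df : \forall x \near x0, derivable f x 1.
  by apply: filterS nearU => x /f_C2[].
suff TD : tao_quotient2 f x0 W (w W) @[W --> 0^'+] --> f^`(2)%classic x0.
  split; [by apply/cvg_ex; exists (f^`(2)%classic x0)|exact: cvg_lim TD|].
  exact: (@derive1_cvg_diff_quot R f^`()%classic x0 ddf).
apply/cvgrPdist_le => e e0.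
(* For [W < d], both [x0 + t] and [x0 - t] stay where [f] is differentiable, which provides
   continuity on [[0, W]]. *)
have /nbhs_ballP [d /= d0 Hd] := df.
have := second_difference_bound _ _ _ _ df ddf e0.
apply: filter_app; near=> W => bound.
have W0 : 0 < W by near: W; exact: nbhs_right_gt.
have Wd : W < d by near: W; exact: nbhs_right_lt.
rewrite distrC; apply: (tao_quotient2_dist_le _ _ _ _ _ _ _ W0 (w_norm W W0)).
- apply: derivable_within_continuous => t; rewrite in_itv /= => /andP[t0 tW].
  apply: (@ex_derive _ _ _ _ _ _ _ (is_derive_shiftl _ _ _ _ _)).
  apply: Hd; rewrite /ball /= opprD addNKr normrN ger0_norm//.
  exact: le_lt_trans Wd.
- apply: derivable_within_continuous => t; rewrite in_itv /= => /andP[t0 tW].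
  apply: (@ex_derive _ _ _ _ _ _ _ (is_derive_reflect _ _ _ _ _)).
  apply: Hd; rewrite /ball /= opprB addrC subrK ger0_norm//.
  exact: le_lt_trans Wd.
- exact: bound.
Unshelve. all: by end_near. Qed.
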